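(* Let $\alpha\in[0,1)$ be rational and let $G\in\mathfrak F_n$ (with respect to $\alpha$) with $n\geqslant 5$. If $U\in\Gamma_\alpha(G)$ has level $l$, then $l$ is odd, except possibly when $n$ is even and $c_\alpha$ is odd with $c_\alpha\geqslant 3$.
   Context: All graphs are finite, simple and undirected; $G$ is connected (standing assumption). For a graph $G$ on $n$ vertices, $A(G)$ is its adjacency matrix, $D(G)$ its diagonal degree matrix, $A_\alpha(G)=\alpha D(G)+(1-\alpha)A(G)$. For rational $\alpha\in[0,1)$, $c_\alpha$ is the smallest positive integer such that $c_\alpha\alpha$ and $c_\alpha(1-\alpha)$ are integers, and $A_{c_\alpha}(G)=c_\alpha A_\alpha(G)$. $\mathbf 1$ is the all-ones vector and $\tilde W_\alpha(G)=\left[\mathbf 1,\frac{A_{c_\alpha}(G)\mathbf 1}{c_\alpha},\dots,\frac{A_{c_\alpha}(G)^{n-1}\mathbf 1}{c_\alpha}\right]$ (an integral matrix). $\mathfrak F_n$ is the set of graphs $G$ on $n$ vertices such that $\frac{\det\tilde W_\alpha(G)}{2^{\lfloor n/2\rfloor}}$ is an odd square-free integer and $\tilde W_\alpha(G)$ has rank $n$ over $\mathbb F_p$ for each odd prime $p\mid c_\alpha$. $O_n(\mathbb Q)$ is the set of $n\times n$ rational orthogonal matrices and $\Gamma_\alpha(G)=\{U\in O_n(\mathbb Q): U\mathbf 1=\mathbf 1,\ U^TA_{c_\alpha}(G)U=A_{c_\alpha}(H)\text{ for some graph }H\}$. The level of a rational orthogonal matrix $U$ is the smallest positive integer $k$ such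 that $kU$ is integral. *)

(* Defs.v *)
From HB Require Import structures.
From mathcomp Require Import all_boot all_order all_algebra.

Set Implicit Arguments.
Unset Strict Implicit.
Unset Printing Implicit Defensive.

Import Order.TTheory GRing.Theory Num.Theory.

Local Open Scope ring_scope.

Record sgraph (n : nat) := SGraph {
  adj :> rel 'I_n;
  adj_sym : symmetric adj;
  adj_irr : irreflexive adj }.

Definition connected (n : nat) (G : sgraph n) : Prop :=
  forall u v : 'I_n, connect G u v.

Definition degree (n : nat) (G : sgraph n) (u : 'I_n) : nat :=
  #|[set v | G u v]|.

Definition adjm (n : nat) (G : sgraph n) : 'M[rat]_n :=
  \matrix_(u, v) (G u v)%:R.

Definition degm (n : nat) (G : sgraph n) : 'M[rat]_n :=
  diag_mx (\row_u (degree G u)%:R).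

Definition Aalpha (alpha : rat) (n : nat) (G : sgraph n) : 'M[rat]_n :=
  alpha *: degm G + (1 - alpha) *: adjm G.

Definition c_alpha_pred (alpha : rat) (c : nat) : bool :=
  [&& (0 < c)%N, c%:R * alpha \is a Num.int
    & c%:R * (1 - alpha) \is a Num.int].

Lemma c_alpha_ex (alpha : rat) : exists c, c_alpha_pred alpha c.
Proof.
exists `|denq alpha|%N.
have cE : (`|denq alpha|%N)%:R = (denq alpha)%:~R :> rat.
  by rewrite -[in RHS]absz_denq.
have cI : (`|denq alpha|%N)%:R * alpha \is a Num.int.
  by rewrite cE mulrC -numqE intr_int.
rewrite /c_alpha_pred absz_gt0 denq_neq0 cI mulrBr mulr1 /=.
by rewrite rpredB // natr_int.
Qed.

Definition c_alpha (alpha : rat) : nat := ex_minn (c_alpha_ex alpha).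

Definition Acalpha (alpha : rat) (n : nat) (G : sgraph n) : 'M[rat]_n :=
  (c_alpha alpha)%:R *: Aalpha alpha G.

Definition ones (n : nat) : 'cV[rat]_n := const_mx 1.

Definition Wtilde (alpha : rat) (n : nat) (G : sgraph n) : 'M[rat]_n :=
  \matrix_(i, j)
    if j == 0%N :> nat then ones n i 0
    else (Acalpha alpha G ^+ j *m ones n) i 0 / (c_alpha alpha)%:R.

(* Entrywise numerators; by [Wtilde_intE] this is Wtilde itself, seen as an
   integer matrix, so that it can be reduced modulo p. *)
Definition Wtilde_int (alpha : rat) (n : nat) (G : sgraph n) : 'M[int]_n :=
  map_mx numq (Wtilde alpha G).

Definition squarefree (m : int) : Prop :=
  forall d : nat, (d ^ 2 %| `|m|)%N -> d = 1%N.

Definition in_F (alpha : rat) (n : nat) (G : sgraph n) : Prop :=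
  (exists m : int, [/\ \det (Wtilde alpha G) / 2 ^+ n./2 = m%:~R,
                       odd `|m|%N & squarefree m]) /\
  (forall p : nat, prime p -> odd p -> (p %| c_alpha alpha)%N ->
     \rank (map_mx intr (Wtilde_int alpha G) : 'M['F_p]_n) = n).

Definition rat_orthogonal (n : nat) (U : 'M[rat]_n) : Prop :=
  U^T *m U = 1%:M.

Definition in_Gamma (alpha : rat) (n : nat) (G : sgraph n) (U : 'M[rat]_n) :
    Prop :=
  [/\ rat_orthogonal U, U *m ones n = ones n &
      exists H : sgraph n, U^T *m Acalpha alpha G *m U = Acalpha alpha H].

Definition level_pred (n : nat) (U : 'M[rat]_n) (k : nat) : bool :=
  (0 < k)%N && (k%:R *: U \is a mxOver (Num.int : {pred rat})).

Lemma level_ex (n : nat) (U : 'M[rat]_n) : exists k, level_pred U k.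
Proof.
pose d (x : 'I_n * 'I_n) := `|denq (U x.1 x.2)|%N.
exists (\prod_x d x)%N; apply/andP; split.
  by apply: prodn_gt0 => x; rewrite absz_gt0 denq_neq0.
apply/mxOverP => i j; rewrite mxE (bigD1 (i, j)) //= natrM mulrAC.
rewrite rpredM ?natr_int //.
have -> : (d (i, j))%:R = (denq (U i j))%:~R :> rat.
  by rewrite -[in RHS]absz_denq.
by rewrite mulrC -numqE intr_int.
Qed.

Definition level (n : nat) (U : 'M[rat]_n) : nat := ex_minn (level_ex U).

Lemma c_alphaP (alpha : rat) : c_alpha_pred alpha (c_alpha alpha).
Proof. by rewrite /c_alpha; case: ex_minnP. Qed.

Lemma Acalpha_int (alpha : rat) (n : nat) (G : sgraph n) :
  Acalpha alpha G \is a mxOver (Num.int : {pred rat}).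
Proof.
have /and3P[_ ca cb] := c_alphaP alpha.
apply/mxOverP => i j; rewrite /Acalpha scalerDr !scalerA !mxE.
by rewrite rpredD // rpredM // ?rpredMn ?natr_int.
Qed.

Lemma Aalpha_ones (alpha : rat) (n : nat) (G : sgraph n) :
  Aalpha alpha G *m ones n = \col_u (degree G u)%:R.
Proof.
have dE : degm G *m ones n = \col_u (degree G u)%:R.
  by apply/matrixP => i j; rewrite mul_diag_mx !mxE mulr1.
have aE : adjm G *m ones n = \col_u (degree G u)%:R.
  apply/matrixP => i j; rewrite !mxE /degree -sum1_card natr_sum.
  rewrite [RHS]big_mkcond /=; apply: eq_bigr => v _.
  by rewrite !mxE inE mulr1; case: (G i v).
by rewrite mulmxDl -!scalemxAl dE aE -scalerDl addrC subrK scale1r.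
Qed.

Lemma Wtilde_intE (alpha : rat) (n : nat) (G : sgraph n) :
  map_mx intr (Wtilde_int alpha G) = Wtilde alpha G.
Proof.
have /and3P[c0 _ _] := c_alphaP alpha.
suff WI i j : Wtilde alpha G i j \is a Num.int.
  apply/matrixP => i j; rewrite [LHS]mxE [X in X%:~R]mxE.
  by have /intrP[m ->] := WI i j; rewrite numq_int.
rewrite mxE; case: (nat_of_ord j) => [|k] /=; first by rewrite mxE rpred1.
rewrite exprSr -mulmxE -mulmxA {2}/Acalpha -scalemxAl -scalemxAr Aalpha_ones.
rewrite mxE mulrC mulKf ?pnatr_eq0 -?lt0n // mxE.
apply: rpred_sum => u _; rewrite [X in _ * X]mxE rpredM ?natr_int //.
elim: k i u => [|k IH] i u; first by rewrite expr0 mxE natr_int.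
rewrite exprS -mulmxE mxE; apply: rpred_sum => v _; rewrite rpredM //.
by have /mxOverP := Acalpha_int alpha G; apply.
Qed.

(* Main.v *)
(* Write Q = l U, an integral matrix with Q^T A^k Q = l^2 B^k and W^T Q = 0 mod l,
   where A, B are the scaled matrices of G, H and W is the walk matrix of G with
   columns w_0 = 1 and w_(j+1) = A^j d. An odd prime p dividing l would force
   p^2 to divide det W: a column u of Q spans the kernel of W^T mod p, hence is
   an eigenvector of A mod p, and it lifts to a kernel vector mod p^2.
   At the prime 2, the Gram matrix W^T W has even entries apart from the corner n,
   and the value of det W makes it as invertible as this allows; so 4 does not
   divide l, and w_0, ..., w_(r-1) with r = uphalf n form a basis of the column
   space of W mod 2. Expanding a column u of Q in this basis, u^T A^k u = 0 mod 4
   for all k shows that u is congruent to a multiple of w_0 = 1 mod 2. If l is even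
   then l = 2 and some u has all entries odd, so n <= u^T u = l^2 = 4. *)
Require Import Defs.
From mathcomp Require Import all_boot all_order all_algebra zify ring.

Set Implicit Arguments.
Unset Strict Implicit.
Unset Printing Implicit Defensive.

Import Order.TTheory GRing.Theory Num.Theory.

Local Open Scope ring_scope.

(** * Linear algebra over a field: solvability of a bordered eigenvector system *)

(** Duality: the columns of [cokermx B] are killed by [B], and testing [A] on them decides the
    inclusion. *)
Lemma sub_of_mulmx0 (F : fieldType) (m1 m2 n : nat)
    (A : 'M[F]_(m1, n)) (B : 'M[F]_(m2, n)) :
  (forall y : 'cV_n, B *m y = 0 -> A *m y = 0) -> (A <= B)%MS.
Proof.
move=> BA; rewrite submxE; apply/eqP/matrixP => i j.
have /matrixP/(_ i 0) : A *m (cokermx B *m delta_mx j (0 : 'I_1)) = 0.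
  by apply: BA; rewrite mulmxA mulmx_coker mul0mx.
by rewrite mulmxA -colE !mxE.
Qed.

(* [K] is a subspace on which [A] acts with cyclic vector [e]; cyclicity makes
   [K / K (A - lam)] at most one-dimensional, hence also the eigenspace. *)
Lemma cyclic_eigenspace (F : fieldType) (m n : nat) (A : 'M[F]_n)
    (K : 'M[F]_(m, n)) (e u y : 'rV[F]_n) (lam s : F) :
  (K <= K *m (A - lam%:M) + e)%MS ->
  (forall z : 'rV_n, (z <= K *m (A - lam%:M))%MS ->
     (z *m A <= K *m (A - lam%:M))%MS) ->
  (u <= K)%MS -> u *m A = lam *: u -> u != 0 ->
  (y <= K)%MS -> y *m (A - lam%:M) = s *: e ->
  s = 0 /\ (y <= u)%MS.
Proof.
set B := A - _; move=> KB BA uK uA un0 yK yB.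
have uB : u *m B = 0 by rewrite mulmxBr uA mul_mx_scalar subrr.
have un : (u <= K :&: kermx B)%MS by rewrite sub_capmx uK; apply/sub_kermxP.
have rk := mxrank_mul_ker K B.
have ru : \rank u = 1%N by rewrite rank_rV un0.
have r1 := mxrankS un; rewrite ru in r1.
have s0 : s = 0.
  apply/eqP/negPn/negP => sn0.
  have eK : (e <= K *m B)%MS.
    have -> : e = s^-1 *: (y *m B) by rewrite yB scalerA mulVf ?scale1r.
    by rewrite scalemx_sub // submxMr.
  have KK : (K <= K *m B)%MS.
    by apply: submx_trans KB _; rewrite addsmx_sub submx_refl.
  have := mxrankS KK; rewrite -rk; lia.
split=> //.
have yk : (y <= K :&: kermx B)%MS.
  by rewrite sub_capmx yK; apply/sub_kermxP; rewrite yB s0 scale0r.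
apply: submx_trans yk _.
have := mxrankS KB; have := mxrank_adds_leqif (K *m B) e => -[le1 _].
have re : (\rank e <= 1)%N by exact: rank_leq_row.
move=> le2; have rc : (\rank (K :&: kermx B) <= 1)%N by lia.
by rewrite -(mxrank_leqif_sup un) ru eqn_leq r1 rc.
Qed.

(** Fredholm alternative: by [cyclic_eigenspace] a vector killed by the bordered matrix is a
    multiple of [u] with border coordinate 0, and [u b^T = 0] makes it kill the right-hand side too.
    This supplies the Hensel correction [v], with a prescribed pairing with [e]. *)
Lemma bordered_solvable (F : fieldType) (m n : nat) (A : 'M[F]_n)
    (K : 'M[F]_(m, n)) (e u b : 'rV[F]_n) (lam t : F) :
  A^T = A ->
  (K <= K *m (A - lam%:M) + e)%MS ->
  (forall z : 'rV_n, (z *m u^T = 0) -> (z <= K)%MS) ->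
  u *m A = lam *: u -> u != 0 -> u *m u^T = 0 -> u *m b^T = 0 ->
  exists v : 'rV_n, exists mu : F,
    v *m (A - lam%:M) + b = mu *: u /\ v *m e^T = t%:M.
Proof.
move=> Asym KB uK uA un0 uu ub.
set B := A - _ in KB *.
have Bsym : B^T = B by rewrite /B linearB /= Asym tr_scalar_mx.
have AB (z : 'rV_n) : (z <= K *m B)%MS -> (z *m A <= K *m B)%MS.
  move=> zK; have -> : z *m A = z *m B + lam *: z.
    by rewrite mulmxBr mul_mx_scalar subrK.
  rewrite addmx_sub ?scalemx_sub //; apply: submxMr.
  apply: submx_trans zK _; apply/row_subP => i; rewrite row_mul.
  apply: uK; rewrite -mulmxA; have -> : B *m u^T = 0; last by rewrite mulmx0.
  by rewrite -Bsym -trmx_mul mulmxBr uA mul_mx_scalar subrr trmx0.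
have sol : (row_mx (- b) t%:M <= block_mx B e^T u (0 : 'M_1))%MS.
  apply: sub_of_mulmx0 => y; rewrite -[y]vsubmxK mul_row_col mul_block_col.
  set y1 := usubmx y; set s := dsubmx y => /eqP.
  rewrite col_mx_eq0 mul0mx addr0 => /andP[/eqP h1 /eqP h2].
  have sE : s = (s 0 0)%:M by rewrite -mx11_scalar.
  have yB : y1^T *m B = (- s 0 0) *: e.
    rewrite -Bsym -trmx_mul; move/eqP: h1; rewrite addr_eq0 => /eqP ->.
    by rewrite {1}sE mul_mx_scalar linearN linearZ /= trmxK mxE scaleNr.
  have yK : (y1^T <= K)%MS by apply: uK; rewrite -trmx_mul h2 trmx0.
  have uKK : (u <= K)%MS by exact: uK.
  have [s0 yu] := cyclic_eigenspace KB AB uKK uA un0 yK yB.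
  have {}s0 : s = 0 by rewrite sE (oppr_inj (etrans s0 (esym (oppr0 _)))) raddf0.
  have [k yE] := sub_rVP yu.
  have -> : y1 = k *: u^T by rewrite -[y1]trmxK yE linearZ.
  rewrite s0 mulmx0 addr0 mulNmx -scalemxAr -[b]trmxK -trmx_mul ub.
  by rewrite trmx0 scaler0 oppr0.
have /submxP[D] := sol; rewrite -[D]hsubmxK mul_row_block.
rewrite mulmx0 addr0 => /eq_row_mx[h1 h2].
exists (lsubmx D), (- (rsubmx D) 0 0); split; last by rewrite h2.
move/eqP: h1; rewrite eqr_oppLR => /eqP ->.
by rewrite opprD addNKr [rsubmx D in LHS]mx11_scalar mul_scalar_mx scaleNr.
Qed.

(** * Integer matrices all of whose entries are divisible by [q] *)

Local Notation multmx q := (mxOver (dvdz q%:Z)).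

Lemma mult_entryP (q m n : nat) (M : 'M[int]_(m, n)) :
  reflect (forall i j, (q %| M i j)%Z) (M \is a multmx q).
Proof. exact: mxOverP. Qed.
Arguments mult_entryP {q m n M}.

Lemma multmxP (q m n : nat) (M : 'M[int]_(m, n)) :
  reflect (exists N : 'M[int]_(m, n), M = q%:Z *: N) (M \is a multmx q).
Proof.
apply: (iffP mult_entryP) => [qM | [N ->] i j]; last by rewrite mxE dvdz_mulr.
exists (\matrix_(i, j) (M i j %/ q%:Z)%Z).
by apply/matrixP => i j; rewrite !mxE mulrC divzK.
Qed.

Lemma multmxM (q1 q2 m n k : nat) (M : 'M[int]_(m, n)) (N : 'M[int]_(n, k)) :
  M \is a multmx q1 -> N \is a multmx q2 -> M *m N \is a multmx (q1 * q2)%N.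
Proof.
move=> /mult_entryP qM /mult_entryP qN; apply/mult_entryP => i j; rewrite mxE.
by apply: rpred_sum => l _; rewrite PoszM; apply: dvdz_mul; rewrite ?qM ?qN.
Qed.

Lemma multmxMl (q m n k : nat) (M : 'M[int]_(m, n)) (N : 'M[int]_(n, k)) :
  M \is a multmx q -> M *m N \is a multmx q.
Proof.
by move=> qM; rewrite -[q]muln1 multmxM //; apply/mult_entryP => *; apply: dvd1z.
Qed.

Lemma multmxMr (q m n k : nat) (M : 'M[int]_(m, n)) (N : 'M[int]_(n, k)) :
  N \is a multmx q -> M *m N \is a multmx q.
Proof.
by move=> qM; rewrite -[q]mul1n multmxM //; apply/mult_entryP => *; apply: dvd1z.
Qed.

Lemma multmxZ (q1 q2 m n : nat) (M : 'M[int]_(m, n)) :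
  M \is a multmx q2 -> q1%:Z *: M \is a multmx (q1 * q2)%N.
Proof. by move=> /multmxP[N ->]; apply/multmxP; exists N; rewrite scalerA. Qed.

Lemma multmxZr (q m n : nat) (a : int) (M : 'M[int]_(m, n)) :
  M \is a multmx q -> a *: M \is a multmx q.
Proof.
by move=> /mult_entryP M_q; apply/mult_entryP => i j; rewrite mxE dvdz_mull.
Qed.

Lemma multmx_pcancel (q1 q2 m n : nat) (M : 'M[int]_(m, n)) : (0 < q1)%N ->
  (q1%:Z *: M \is a multmx (q1 * q2)%N) = (M \is a multmx q2).
Proof.
move=> q1_gt0; apply/mult_entryP/mult_entryP => H i j; have := H i j.
  by rewrite mxE PoszM dvdz_mul2l // eqz_nat -lt0n.
by move=> Mij; rewrite mxE PoszM dvdz_mul2l // eqz_nat -lt0n.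
Qed.

Lemma multmx_Gauss (q m n : nat) (a : int) (M : 'M[int]_(m, n)) :
  coprimez q a -> (a *: M \is a multmx q) = (M \is a multmx q).
Proof.
move=> qa; apply/mult_entryP/mult_entryP => H i j; have := H i j.
  by rewrite mxE Gauss_dvdzr.
by move=> Mij; rewrite mxE Gauss_dvdzr.
Qed.

Lemma tr_multmx (q m n : nat) (M : 'M[int]_(m, n)) :
  (M^T \is a multmx q) = (M \is a multmx q).
Proof. by apply/mult_entryP/mult_entryP => H i j; have := H j i; rewrite mxE. Qed.

Lemma multmx11 (q : nat) (M : 'M[int]_1) :
  (M \is a multmx q) = (q %| M 0%R 0%R)%Z.
Proof. by apply/mult_entryP/idP => [->//|H i j]; rewrite !ord1. Qed.

Lemma multmx_Fp (p m n : nat) (M : 'M[int]_(m, n)) : prime p ->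
  (M \is a multmx p) = (map_mx intr M == 0 :> 'M['F_p]_(m, n)).
Proof.
move=> p_pr; have dvdF := dvdz_pcharf (pchar_Fp p_pr).
apply/mult_entryP/eqP => [H | /matrixP H i j].
  by apply/matrixP => i j; rewrite !mxE; apply/eqP; rewrite -dvdF; apply: H.
by rewrite dvdF; have := H i j; rewrite !mxE => ->.
Qed.

Lemma intr_Fp_surj (p m n : nat) (M : 'M['F_p]_(m, n)) :
  exists N : 'M[int]_(m, n), map_mx intr N = M.
Proof.
exists (map_mx (fun x : 'F_p => (x : nat)%:Z) M).
by apply/matrixP => i j; rewrite !mxE -pmulrn natr_Zp.
Qed.

(** * Rank modulo a prime, walk matrices, and odd primes dividing the level *)

(** The Smith invariants form a divisibility chain, so if [p] divided one before the last it would
    divide the last as well, hence [p ^ 2] would divide the determinant. *)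
Lemma mxrank_Fp_ge (p n : nat) (M : 'M[int]_n) : prime p ->
  ~~ ((p ^ 2)%N %| \det M)%Z ->
  (n.-1 <= \rank (map_mx intr M : 'M['F_p]_n))%N.
Proof.
move=> p_pr; case: n M => [|n] M Hdet //=.
have dvdF := dvdz_pcharf (pchar_Fp p_pr).
have [L Lu [R Ru [d d_sorted ME]]] := int_Smith_normal_form M.
have DE : \matrix_(i, j) (d`_i *+ (i == j :> nat)) =
          diag_mx (\row_(i < n.+1) d`_i).
  by apply/matrixP => i j; rewrite !mxE.
rewrite {}DE in ME; set D := diag_mx _ in ME.
have dvd_d (i : 'I_n) : ~~ (p %| d`_i)%Z.
  apply: contra Hdet => p_di.
  have p_dn : (p %| d`_n)%Z.
    have [le_dn|lt_nd] := leqP (size d) n; first by rewrite nth_default ?dvdz0.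
    apply: dvdz_trans p_di _; apply: (sorted_leq_nth _ _ 0 d_sorted) => //.
    - exact: dvdz_trans.
    - exact: dvdzz.
    - by rewrite inE (ltn_trans (ltn_ord i)).
    exact: ltnW.
  rewrite ME !det_mulmx dvdz_mulr // dvdz_mull // det_diag big_ord_recr /=.
  rewrite -mulnn PoszM dvdz_mul //; last by rewrite mxE.
  by rewrite (bigD1 i) //= mxE dvdz_mulr.
have -> : \rank (map_mx intr M : 'M['F_p]_n.+1) =
          \rank (map_mx intr D : 'M['F_p]_n.+1).
  rewrite ME !map_mxM mxrankMfree; last first.
    by rewrite row_free_unit unitmxE det_map_mx rmorph_unit.
  rewrite -mxrank_tr trmx_mul mxrankMfree ?mxrank_tr //.
  by rewrite row_free_unit unitmx_tr unitmxE det_map_mx rmorph_unit.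
(* Replacing the last invariant by 1 is a change of rank at most one and makes the diagonal matrix
   invertible. *)
pose E := delta_mx ord_max ord_max : 'M['F_p]_n.+1.
pose k : 'F_p := 1 - (d`_n)%:~R.
have DU : map_mx intr D + k *: E \in unitmx.
  have -> : map_mx intr D + k *: E =
     diag_mx (\row_(i < n.+1) (if i == ord_max then 1 else (d`_i)%:~R)).
    apply/matrixP => i j; rewrite !mxE; have [<-|ij] := eqVneq i j.
      have [->|_] := eqVneq i ord_max; last by rewrite /= mulr0 addr0.
      by rewrite /= mulr1 /k addrC subrK.
    have [iE|_] := eqVneq i ord_max; last by rewrite /= mulr0 addr0.
    have [jE|_] := eqVneq j ord_max; last by rewrite /= mulr0 addr0.
    by rewrite iE jE eqxx in ij.
  rewrite unitmxE det_diag unitfE prodf_seq_neq0; apply/allP => i _ /=.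
  rewrite mxE; have [_|ine] := eqVneq i ord_max; first exact: oner_neq0.
  have lt_in : (i < n)%N.
    by rewrite ltn_neqAle -ltnS ltn_ord andbT; apply: contra ine => /eqP iE;
       apply/eqP/val_inj.
  by rewrite -dvdF; apply: (dvd_d (Ordinal lt_in)).
have kE : (\rank (k *: E) <= 1)%N.
  by rewrite (leq_trans (mxrankS (scalemx_sub k (submx_refl E)))) ?mxrank_delta.
have := mxrank_add (map_mx intr D) (k *: E); rewrite (mxrank_unit DU).
by move/leq_trans/(_ (leq_add (leqnn _) kE)); rewrite addn1 ltnS.
Qed.

(* Since [A *m 1 = c *: d] for the degree vector [d], dividing [A^(k+1) 1] by [c]
   gives [A^k d]. *)
Definition walkv (n : nat) (A : 'M[int]_n) (d : 'cV[int]_n) (j : nat) :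
    'cV[int]_n :=
  if j is k.+1 then A ^+ k *m d else const_mx 1.

Definition walkmx (n : nat) (A : 'M[int]_n) (d : 'cV[int]_n) : 'M[int]_n :=
  \matrix_(i, j) walkv A d j i 0.

Lemma mulmx_walkmx (m n : nat) (A : 'M[int]_n) (d : 'cV[int]_n)
    (X : 'M[int]_(m, n)) i j :
  (X *m walkmx A d) i j = (X *m walkv A d j) i 0.
Proof. by rewrite !mxE; apply: eq_bigr => k _; rewrite mxE. Qed.

Lemma multmx_walkmx (q m n : nat) (A : 'M[int]_n) (d : 'cV[int]_n)
    (X : 'M[int]_(m, n)) :
  (X *m walkmx A d \is a multmx q) <->
  (forall j, (j < n)%N -> X *m walkv A d j \is a multmx q).
Proof.
split=> [/mult_entryP H j lt_jn | H].
  apply/mult_entryP => i k; rewrite ord1; have := H i (Ordinal lt_jn).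
  by rewrite mulmx_walkmx.
apply/mult_entryP => i j; rewrite mulmx_walkmx.
by have /mult_entryP/(_ i 0) := H j (ltn_ord j).
Qed.

Lemma walkvS (n : nat) (A : 'M[int]_n) (d : 'cV[int]_n) (c j : nat) :
  A *m const_mx 1 = c%:Z *: d ->
  A *m walkv A d j = (if j == 0%N then c%:Z else 1) *: walkv A d j.+1.
Proof.
move=> Ae; case: j => [|j]; first by rewrite Ae /= expr0 mul1mx.
by rewrite /= mulmxA exprS mulmxE scale1r.
Qed.

(** Multiplying by the adjugate turns [u M] into [det M] times [u], and some entry of [u] is prime
    to [p]. *)
Lemma dvd_det_of_mulmx (q p n : nat) (M : 'M[int]_n) (u : 'rV[int]_n) :
  prime p -> u \isn't a multmx p -> u *m M \is a multmx (p ^ q)%N ->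
  ((p ^ q)%N %| \det M)%Z.
Proof.
move=> p_pr un /(multmxMl (\adj M)).
rewrite -mulmxA mul_mx_adj mul_mx_scalar => /mult_entryP uM.
have /existsP[i un_i] : [exists i, ~~ (p %| u 0%R i)%Z].
  apply: contraR un; rewrite negb_exists => /forallP H.
  by apply/mult_entryP => i j; rewrite ord1; apply/negbNE/H.
have := uM 0 i; rewrite mxE mulrC Gauss_dvdzr //.
by rewrite coprimezE /= coprimeXl // prime_coprime // -dvdzE.
Qed.

(* The kernel of [walkmx^T] mod [p] is spanned by [u], so [u] is an eigenvector
   mod [p]; since [u u^T] and [u A u^T] vanish mod [p ^ 2], Hensel lifting makes
   it an eigenvector mod [p ^ 2] still orthogonal to the all-ones vector. *)
Lemma sq_dvd_det_walkmx (p c n : nat) (A : 'M[int]_n) (d : 'cV[int]_n)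
    (u : 'rV[int]_n) :
  prime p -> coprime p c -> A^T = A -> A *m const_mx 1 = c%:Z *: d ->
  u *m u^T \is a multmx (p ^ 2)%N -> u *m A *m u^T \is a multmx (p ^ 2)%N ->
  (forall k, u *m (A ^+ k *m d) \is a multmx p) ->
  u *m (const_mx 1 : 'cV_n) \is a multmx p ->
  u \isn't a multmx p ->
  ((p ^ 2)%N %| \det (walkmx A d))%Z.
Proof.
move=> p_pr pc Asym Ae uu uAu uAd ue un.
apply/negPn/negP => Hdet; have p_gt0 := prime_gt0 p_pr.
set W := walkmx A d in Hdet.
pose F := 'F_p; pose red := fun m k (M : 'M[int]_(m, k)) =>
  map_mx intr M : 'M[F]_(m, k).
have red0 m k (M : 'M[int]_(m, k)) : M \is a multmx p -> red _ _ M = 0.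
  by rewrite multmx_Fp // => /eqP.
have redM m k l (M : 'M[int]_(m, k)) (N : 'M[int]_(k, l)) :
    red _ _ (M *m N) = red _ _ M *m red _ _ N by apply: map_mxM.
have redT m k (M : 'M[int]_(m, k)) : red _ _ M^T = (red _ _ M)^T.
  by rewrite /red map_trmx.
have redZ m k a (M : 'M[int]_(m, k)) : red _ _ (a *: M) = a%:~R *: red _ _ M.
  by rewrite /red map_mxZ.
have redW m k (M N : 'M[int]_(m, k)) :
    red _ _ M = red _ _ N -> M - N \is a multmx p.
  by move=> MN; rewrite multmx_Fp // map_mxB subr_eq0; apply/eqP.
pose u_ := red _ _ u; pose A_ := red _ _ A; pose K := (red _ _ W)^T.
pose e_ := (red _ _ (const_mx 1 : 'cV_n))^T.
have un_ : u_ != 0 by rewrite /u_ /red -multmx_Fp.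
have uW : u *m W \is a multmx p by apply/multmx_walkmx => -[|j] _ //=.
have uAW : u *m A *m W \is a multmx p.
  apply/multmx_walkmx => j _; rewrite -mulmxA (walkvS _ Ae) -scalemxAr.
  by rewrite multmxZr //=.
have A_sym : A_^T = A_ by rewrite /A_ -redT Asym.
have rK : (n.-1 <= \rank K)%N by rewrite mxrank_tr mxrank_Fp_ge.
have r1 : \rank u_ = 1%N by rewrite rank_rV un_.
have Ku : K *m u_^T = 0 by rewrite -trmx_mul -redM red0 ?trmx0.
(* [K] lies in the orthogonal of [u], of dimension [n.-1], and has at least that rank, so the two
   coincide. *)
have K_max (z : 'rV_n) : z *m u_^T = 0 -> (z <= K)%MS.
  move=> zu; have zk : (z <= kermx u_^T)%MS by apply/sub_kermxP.
  apply: submx_trans zk _.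
  have Kk : (K <= kermx u_^T)%MS by apply/sub_kermxP.
  have rk : \rank (kermx u_^T) = n.-1 by rewrite mxrank_ker mxrank_tr r1 subn1.
  by rewrite -(mxrank_leqif_sup Kk) eqn_leq rk rK -rk mxrankS.
(* The left kernel of the walk matrix mod [p] has dimension at most 1 and contains both [u] and
   [u A]. *)
have [lam_ uA_] : exists lam, u_ *m A_ = lam *: u_.
  apply/sub_rVP; have uk : (u_ <= kermx K^T)%MS.
    by apply/sub_kermxP; rewrite trmxK -redM red0.
  have : (u_ *m A_ <= kermx K^T)%MS.
    by apply/sub_kermxP; rewrite trmxK -!redM red0.
  move/submx_trans; apply; rewrite -(mxrank_leqif_sup uk) r1 eqn_leq.
  rewrite -{1}r1 mxrankS //= mxrank_ker mxrank_tr leq_subLR addn1.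
  by rewrite (leq_trans (leqSpred n)).
(* Induction along the walk: up to a unit, [w_(j+1)] is [w_j A = w_j (A - lam) + lam w_j], starting
   from [w_0 = e]. *)
have KB : (K <= K *m (A_ - lam_%:M) + e_)%MS.
  set B := A_ - _; have AB (z : 'rV_n) : z *m A_ = z *m B + lam_ *: z.
    by rewrite mulmxBr mul_mx_scalar subrK.
  have rowK j : row j K = (red _ _ (walkv A d j))^T.
    by apply/rowP => i; rewrite !mxE.
  pose w_ j := (red _ _ (walkv A d j))^T.
  have wA j : w_ j *m A_ = (if j == 0%N then c%:R else 1) *: w_ j.+1.
    rewrite /w_ -A_sym -trmx_mul -redM (walkvS _ Ae) redZ linearZ /=.
    by case: (j == 0%N); rewrite ?pmulrn.
  apply/row_subP => i; rewrite rowK -/(w_ i).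
  case: i => j /=; elim: j => [|j IH] lt_jn; first exact: addsmxSr.
  have c_unit : (if j == 0%N then c%:R else 1 : F) != 0.
    case: (j == 0%N); last exact: oner_neq0.
    by rewrite -(dvdn_pcharf (pchar_Fp p_pr)) -prime_coprime.
  have -> : w_ j.+1 = (if j == 0%N then c%:R else 1)^-1 *: (w_ j *m A_).
    by rewrite wA scalerA mulVf ?scale1r.
  rewrite scalemx_sub // AB addmx_sub ?scalemx_sub ?IH // 1?ltnW //.
  apply: submx_trans (addsmxSl _ _); apply: submxMr.
  by have := row_sub (Ordinal (ltnW lt_jn)) K; rewrite rowK.
have [lam0 lamE] := intr_Fp_surj (const_mx lam_ : 'M_1).
pose lam := lam0 0 0; have {lamE} lamE : lam%:~R = lam_ :> F.
  by move/matrixP/(_ 0 0): lamE; rewrite !mxE.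
have [b uAE] : exists b, u *m A - lam *: u = p%:Z *: b.
  by apply/multmxP/redW; rewrite redM redZ lamE.
(* Here [p u b^T = u A u^T - lam u u^T] vanishes mod [p ^ 2]. *)
have ub : red _ _ u *m (red _ _ b)^T = 0.
  rewrite -redT -redM red0 //; rewrite -(multmx_pcancel p _ p_gt0) mulnn.
  rewrite scalemxAr -linearZ /= -uAE linearB /= mulmxBr linearZ /=.
  rewrite -scalemxAr rpredB //; last exact: multmxZr.
  by rewrite trmx_mul Asym mulmxA.
have uu_ : u_ *m u_^T = 0.
  rewrite -redT -redM red0 //; have /multmxP[N ->] := uu.
  by apply/multmxP; exists (p%:Z *: N); rewrite scalerA -PoszM mulnn.
have [s ueE] : exists s, u *m (const_mx 1 : 'cV_n) = p%:Z *: s.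
  exact/multmxP.
(* Since [u 1 = p s], the prescribed value [- s] makes [u + p v] orthogonal to the all-ones vector
   mod [p ^ 2]. *)
have [v_ [mu_ [vE ve]]] := bordered_solvable (- red _ _ s 0 0) A_sym KB K_max
  uA_ un_ uu_ ub.
have [v vv] := intr_Fp_surj v_.
have [mu0 muE] := intr_Fp_surj (const_mx mu_ : 'M_1).
pose mu := mu0 0 0; have {muE} muE : mu%:~R = mu_ :> F.
  by move/matrixP/(_ 0 0): muE; rewrite !mxE.
have [g gE] : exists g, v *m (A - lam%:M) + b - mu *: u = p%:Z *: g.
  apply/multmxP/redW; rewrite /red map_mxD map_mxM map_mxB map_scalar_mx /=.
  by rewrite lamE vv map_mxZ /= muE.
pose u' := u + p%:Z *: v.
have un' : u' \isn't a multmx p.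
  apply: contra un => u'p; have -> : u = u' - p%:Z *: v by rewrite addrK.
  by rewrite rpredB //; apply/multmxP; exists v.
have u'A : u' *m A = (lam + p%:Z * mu) *: u' + (p ^ 2)%N%:Z *: (g - mu *: v).
  have vA : v *m A = lam *: v + p%:Z *: g + mu *: u - b.
    by rewrite -gE mulmxBr mul_mx_scalar; apply/matrixP => i j; rewrite !mxE; ring.
  have uA : u *m A = lam *: u + p%:Z *: b by rewrite -uAE addrC subrK.
  rewrite mulmxDl -scalemxAl vA uA -mulnn PoszM.
  by apply/matrixP => i j; rewrite !mxE; ring.
have u'e k : u' *m (A ^+ k *m (const_mx 1 : 'cV_n)) \is a multmx (p ^ 2)%N.
  elim: k => [|k IH].
    rewrite expr0 mul1mx mulmxDl -scalemxAl ueE -scalerDr -mulnn multmx_pcancel //.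
    rewrite multmx_Fp // map_mxD map_mxM vv.
    move: ve; rewrite /e_ trmxK => ->.
    by rewrite [X in X + _]mx11_scalar -raddfD /= subrr raddf0.
  rewrite exprS -mulmxE -mulmxA mulmxA u'A mulmxDl -!scalemxAl.
  rewrite rpredD //; first exact: multmxZr.
  apply/multmxP.
  by exists ((g - mu *: v) *m (A ^+ k *m const_mx 1)).
case/negP: Hdet; apply: (dvd_det_of_mulmx p_pr un').
apply/multmx_walkmx => -[|j] _ /=; first by have := u'e 0%N; rewrite expr0 mul1mx.
(* [A^j d] is [A^(j+1) 1] divided by [c], and [c] is a unit mod [p ^ 2]. *)
rewrite -(@multmx_Gauss _ _ _ c%:Z); last by rewrite coprimezE /= coprimeXl.
rewrite !scalemxAr -Ae [_ *m (A *m _)]mulmxA mulmxE -exprSr; exact: u'e.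
Qed.

(** * Integral quadratic forms modulo 2 and 4 *)

Lemma trmxX (R : comNzRingType) (n : nat) (A : 'M[R]_n) (k : nat) :
  (A ^+ k)^T = A^T ^+ k.
Proof.
elim: k => [|k IH]; first by rewrite !expr0 trmx1.
by rewrite exprS -mulmxE trmx_mul IH mulmxE exprSr.
Qed.

Lemma trmx11 (R : nzRingType) (M : 'M[R]_1) : M^T = M.
Proof. by apply/matrixP => i j; rewrite mxE !ord1. Qed.

(* The off-diagonal entries of a symmetric matrix come in equal pairs, which
   gains a factor 2. *)
Lemma quad_form_diag (q n : nat) (M : 'M[int]_n) (x : 'cV[int]_n) :
  M^T = M -> (forall i j, i != j -> (q %| M i j)%Z) ->
  x^T *m M *m x - x^T *m diag_mx (\row_i M i i) *m x \is a multmx (2 * q)%N.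
Proof.
move=> Msym Mq; pose T := \matrix_(i, j) (if (j < i)%N then M i j else 0).
have ME : M = T + T^T + diag_mx (\row_i M i i).
  apply/matrixP => i j; rewrite !mxE.
  have -> : M j i = M i j by rewrite -{1}Msym mxE.
  have [<-|ij] := eqVneq i j; first by rewrite ltnn !add0r.
  by case: ltngtP => [||/val_inj e]; rewrite ?addr0 ?add0r //; rewrite e eqxx in ij.
rewrite {1}ME !mulmxDr !mulmxDl addrK.
rewrite -[x^T *m T^T *m x]trmx11 !trmx_mul !trmxK mulmxA -mulr2n -scaler_nat.
apply: multmxZ; rewrite multmxMl // multmxMr //.
apply/mult_entryP => i j; rewrite mxE; case: ifP => [ji|_]; last exact: dvdz0.
by apply: Mq; apply: contraTneq ji => ->; rewrite ltnn.
Qed.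

(** Off-diagonal terms pair up, and squares may be dropped because [x^2 - x] is even. *)
Lemma quad_form_mod2 (n : nat) (M : 'M[int]_n) (x : 'cV[int]_n) :
  M^T = M -> x^T *m M *m x - \row_i M i i *m x \is a multmx 2.
Proof.
move=> Msym.
have := @quad_form_diag 1 n M x Msym (fun i j _ => dvd1z _).
rewrite muln1; set Q := _ *m diag_mx _ *m _ => H.
have -> : x^T *m M *m x - \row_i M i i *m x =
    (x^T *m M *m x - Q) + (Q - \row_i M i i *m x) by rewrite addrA subrK.
rewrite rpredD // /Q.
rewrite mul_mx_diag -mulmxBl; apply/mult_entryP => i j; rewrite mxE.
apply: rpred_sum => k _; rewrite !mxE (ord1 i) (ord1 j).
have -> : (x k 0 * M k k - M k k) * x k 0 = M k k * (x k 0 * (x k 0 - 1)) by ring.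
apply: dvdz_mull; case: (boolP (2 %| x k 0%R)%Z) => [x2|x2].
  exact: dvdz_mulr.
by apply: dvdz_mull; lia.
Qed.

(** The guaranteed common divisor of column [j] of [W^T W], whose corner entry is [n]. The product
    over all [j] is exactly the power of 2 in [(det W)^2]. *)
Definition gram_div (n j : nat) : nat :=
  if (j == 0%N) && odd n then 1%N else 2%N.

Lemma prod_gram_div (n : nat) :
  (\prod_(j < n) gram_div n j = 2 ^ n./2 * 2 ^ n./2)%N.
Proof.
rewrite -expnD addnn; case: n => [|n]; first by rewrite big_ord0.
rewrite big_ord_recl {2}/gram_div prod_nat_const card_ord /gram_div /=.
rewrite uphalf_half doubleD -[X in (_ * _ ^ X)%N](odd_double_half n).
by case: (odd n); rewrite /= ?mul1n -?expnS ?add0n.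
Qed.

Lemma sum_even_index (V : nmodType) (n : nat) (F : nat -> V) :
  \sum_(j < n) (if odd j then 0 else F j./2) = \sum_(i < uphalf n) F i.
Proof.
elim: n => [|n IH]; first by rewrite !big_ord0.
rewrite big_ord_recr IH /= uphalf_half; case: (odd n) => /=; first by rewrite addr0.
by rewrite big_ord_recr.
Qed.

(** * The walk matrix at the prime 2 *)

Section WalkParity.

Variables (n : nat) (A : 'M[int]_n) (d : 'cV[int]_n) (c : nat) (a : int).
Hypothesis A_sym : A^T = A.
Hypothesis A_ones : A *m const_mx 1 = c%:Z *: d.
Hypothesis A_diag : \row_i A i i = a *: d^T.
Hypothesis ones_d : (const_mx 1 : 'cV_n)^T *m d \is a multmx 2.

Local Notation e := (const_mx 1 : 'cV[int]_n).
Local Notation w := (walkv A d).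
Local Notation W := (walkmx A d).

Lemma ones_expA (k : nat) : e^T *m A ^+ k.+1 = c%:Z *: (d^T *m A ^+ k).
Proof.
by rewrite exprS -mulmxE mulmxA -{1}A_sym -trmx_mul A_ones linearZ /= scalemxAl.
Qed.

Lemma ones_walk_even (k : nat) :
  (forall j, (j < k)%N -> d^T *m A ^+ j *m d \is a multmx 2) ->
  e^T *m A ^+ k *m d \is a multmx 2.
Proof.
case: k => [|k] H; first by rewrite expr0 mulmx1.
by rewrite ones_expA -scalemxAl multmxZr // H.
Qed.

(** Strong induction with [x = A^h d], [h = k./2]. For odd [k] the value is [x^T A x], congruent to
    a multiple of [d^T A^h d] since the diagonal of [A] is a multiple of [d]. For even [k] it is
    [x^T x], congruent to [1^T A^h d], which reduces to a smaller exponent or to the even sum of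
    degrees. *)
Lemma degree_walk_even (k : nat) : d^T *m A ^+ k *m d \is a multmx 2.
Proof.
elim/ltn_ind: k => k IH; have kE := odd_double_half k.
move: kE IH; rewrite -addnn; move: k./2 => h kE IH.
pose x := A ^+ h *m d.
have xT : x^T = d^T *m A ^+ h by rewrite trmx_mul trmxX A_sym.
have mx2 (M N : 'M[int]_1) : M - N \is a multmx 2 -> N \is a multmx 2 ->
    M \is a multmx 2.
  by move=> MN N2; rewrite -(subrK N M) rpredD.
case: (boolP (odd k)) kE => k_odd; rewrite (add0n, add1n) => kE.
  have h_lt : (h < k)%N by rewrite -kE ltnS leq_addr.
  have := quad_form_mod2 x A_sym; rewrite A_diag xT => /mx2 H.
  have -> : d^T *m A ^+ k *m d = d^T *m A ^+ h *m A *m x.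
    by rewrite -kE -addSn exprD exprSr -!mulmxE /x !mulmxA.
  by apply: H; rewrite -scalemxAl multmxZr // /x mulmxA; apply: IH.
have := quad_form_mod2 x (trmx1 _ n).
have -> : \row_i (1%:M : 'M[int]_n) i i = e^T.
  by apply/matrixP => i j; rewrite !mxE eqxx.
rewrite mulmx1 xT => /mx2 H.
have -> : d^T *m A ^+ k *m d = d^T *m A ^+ h *m x.
  by rewrite -kE exprD -!mulmxE /x !mulmxA.
apply: H; rewrite /x mulmxA; apply: ones_walk_even => j lt_j; apply: IH.
by rewrite -kE ltn_addr.
Qed.

Lemma walk_pairing_even (k i j : nat) : (0 < i + j)%N ->
  (w i)^T *m A ^+ k *m w j \is a multmx 2.
Proof.
case: i j => [|i] [|j] //= _.
- have -> : e^T *m A ^+ k *m (A ^+ j *m d) = e^T *m A ^+ (k + j) *m d.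
    by rewrite exprD -mulmxE !mulmxA.
  by apply: ones_walk_even => l _; apply: degree_walk_even.
- have -> : (A ^+ i *m d)^T *m A ^+ k *m e = e^T *m A ^+ (k + i) *m d.
    rewrite -[RHS]trmx11 !trmx_mul !trmxX A_sym trmxK addnC exprD -mulmxE.
    by rewrite !mulmxA.
  by apply: ones_walk_even => l _; apply: degree_walk_even.
have -> : (A ^+ i *m d)^T *m A ^+ k *m (A ^+ j *m d) =
    d^T *m A ^+ (i + k + j) *m d.
  by rewrite trmx_mul trmxX A_sym !exprD -!mulmxE !mulmxA.
exact: degree_walk_even.
Qed.

Lemma gramE (k : nat) (i j : 'I_n) :
  (W^T *m A ^+ k *m W) i j = ((w i)^T *m A ^+ k *m w j) 0 0.
Proof.
rewrite mulmx_walkmx -!mulmxA !mxE; apply: eq_bigr => l _.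
by rewrite !mxE.
Qed.

Lemma gram_even (k : nat) (i j : 'I_n) : (0 < i + j)%N ->
  (2 %| (W^T *m A ^+ k *m W) i j)%Z.
Proof. by move=> ij; rewrite gramE -multmx11 walk_pairing_even. Qed.

Variable m : int.
Hypothesis detW : \det W = 2 ^+ n./2 * m.
Hypothesis m_odd : ~~ (2 %| m)%Z.

Lemma coprime2_sq : coprimez 2 (m ^+ 2).
Proof.
have : coprimez 2 m by rewrite coprimezE prime_coprime // -dvdzE.
by move=> co; rewrite coprimezXr.
Qed.

(* All entries of the Gram matrix are even, except that the corner [n] may be
   odd; pulling these factors 2 out of the columns leaves an odd determinant. *)
Lemma gram_factor : exists N : 'M[int]_n,
  W^T *m W = N *m diag_mx (\row_j (gram_div n j)%:Z) /\ \det N = m ^+ 2.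
Proof.
pose N := \matrix_(i, j) ((W^T *m W) i j %/ (gram_div n j)%:Z)%Z : 'M[int]_n.
have NE : W^T *m W = N *m diag_mx (\row_j (gram_div n j)%:Z).
  rewrite mul_mx_diag; apply/matrixP => i j; rewrite [RHS]mxE [N _ _]mxE.
  rewrite [X in _ = _ * X]mxE divzK // /gram_div.
  case: (posnP (i + j)%N) => [/eqP|ij_gt0]; last first.
    case: ifP => _; first exact: dvd1z.
    by have := gram_even 0 ij_gt0; rewrite expr0 mulmx1.
  rewrite addn_eq0 => /andP[/eqP i0 /eqP j0]; rewrite j0 /=.
  have [_|n_even] := boolP (odd n); first exact: dvd1z.
  have -> : (W^T *m W) i j = n%:Z.
    have := gramE 0 i j; rewrite expr0 mulmx1 i0 j0 /= => ->.
    rewrite mulmx1 mxE (eq_bigr (fun _ => 1)) => [|l _]; last by rewrite !mxE.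
    by rewrite sumr_const card_ord natz.
  by rewrite dvdzE dvdn2.
exists N; split=> //.
have := congr1 determinant NE; rewrite !det_mulmx det_tr det_diag detW.
rewrite (eq_bigr (fun j : 'I_n => (gram_div n j)%:Z)) => [|j _]; last by rewrite mxE.
rewrite -(big_morph Posz PoszM (erefl _)) prod_gram_div => H.
have two_neq0 : (2 ^ n./2 * 2 ^ n./2)%N%:Z != 0.
  by rewrite eqz_nat muln_eq0 expn_eq0.
apply: (mulIf two_neq0); rewrite -H PoszM -!rmorphXn /=; ring.
Qed.

(** In the factorization [N D] of the Gram matrix, [det N] is odd, so 4 divides [D y]; the diagonal
    entries of [D] are 1 or 2. *)
Lemma gram_mult4 (y : 'cV[int]_n) :
  W^T *m W *m y \is a multmx 4 -> y \is a multmx 2.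
Proof.
have [N [-> detN]] := gram_factor; rewrite -mulmxA => /(multmxMr (\adj N)).
rewrite mulmxA mul_adj_mx detN mul_scalar_mx multmx_Gauss; last first.
  by have -> : 4%:Z = 2 ^+ 2 by []; rewrite coprimezXl // coprime2_sq.
rewrite mul_diag_mx => /mult_entryP H; apply/mult_entryP => i j.
have := H i j; rewrite !mxE /gram_div; case: ifP => _.
  by rewrite mul1r; apply: dvdz_trans.
by have -> : 4%:Z = 2%:Z * 2%:Z by []; rewrite dvdz_mul2l.
Qed.

(** With [W^T u = 2 v] and [W^T W = N D], the vector [x = 2 D^-1 adj(N) v] is integral because [D]
    divides 2; then [W^T W x = m^2 W^T u], and [W^T] cancels as [det W] is nonzero. *)
Lemma walk_combination (u : 'cV[int]_n) :
  W^T *m u \is a multmx 2 -> exists x : 'cV_n, W *m x = m ^+ 2 *: u.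
Proof.
move=> /multmxP[v Wu]; have [N [NE detN]] := gram_factor.
pose x := \col_i ((2 %/ gram_div n i)%N%:Z * (\adj N *m v) i 0).
exists x; have Dx : diag_mx (\row_j (gram_div n j)%:Z) *m x = 2 *: (\adj N *m v).
  rewrite mul_diag_mx; apply/matrixP => i j; rewrite ord1 !mxE mulrA.
  by rewrite /gram_div; case: ifP.
have Wx : W^T *m (W *m x - m ^+ 2 *: u) = 0.
  rewrite mulmxBr mulmxA NE -mulmxA Dx -!scalemxAr Wu mulmxA mul_mx_adj detN.
  by rewrite mul_scalar_mx !scalerA mulrC subrr.
apply/eqP; rewrite -subr_eq0; move/(congr1 (mulmx (\adj W^T))): Wx.
rewrite mulmxA mul_adj_mx mul_scalar_mx mulmx0 det_tr => /eqP.
rewrite scalemx_eq0 => /orP[|//]; rewrite detW mulf_eq0 expf_eq0 /= andbF /=.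
by move=> /eqP m0; move: m_odd; rewrite m0 dvdz0.
Qed.

(** This excludes levels divisible by 4: the coefficients of [m^2 u] on the walk vectors are even by
    [gram_mult4], and [m] is odd. *)
Lemma walk_mult4 (u : 'cV[int]_n) :
  W^T *m u \is a multmx 4 -> u \is a multmx 2.
Proof.
move=> Wu; have [|x Wx] := @walk_combination u.
  by have /multmxP[v ->] := Wu; apply/multmxP; exists (2 *: v); rewrite scalerA.
have x2 : x \is a multmx 2.
  by apply: gram_mult4; rewrite -mulmxA Wx -scalemxAr multmxZr.
by rewrite -(multmx_Gauss _ coprime2_sq) -Wx multmxMr.
Qed.

Lemma mul_walkmx_col (y : nat -> int) :
  W *m (\col_j y j) = \sum_(j < n) y j *: w j.
Proof.
apply/matrixP => i k; rewrite ord1 mxE summxE; apply: eq_bigr => j _.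
by rewrite !mxE mulrC.
Qed.

(** Since [c w_j = A^j 1] for positive [j], both pairings are [1^T A^(k+2i) 1] up to powers of [c];
    the scalars compensate for [w_0], which carries no division by [c]. *)
Lemma walk_square (k i : nat) :
  (if i == 0%N then c%:Z else 1) *: ((w k)^T *m w i.*2) =
  (if k == 0%N then c%:Z else 1) *: ((w i)^T *m A ^+ k *m w i).
Proof.
case: i k => [|i] [|k] //=; rewrite ?scale1r.
- by rewrite expr0 mulmx1.
- by rewrite ones_expA -scalemxAl trmx_mul trmxX A_sym.
- rewrite expr0 mulmx1 mulmxA ones_expA -scalemxAl trmx_mul trmxX A_sym.
  by rewrite -addnn exprD -mulmxE !mulmxA.
transitivity (d^T *m A ^+ (k + i.*2.+1) *m d).
  by rewrite trmx_mul trmxX A_sym exprD -mulmxE !mulmxA.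
have -> : (k + i.*2.+1 = i + k.+1 + i)%N by lia.
by rewrite trmx_mul trmxX A_sym !exprD -!mulmxE !mulmxA.
Qed.

(* By [walk_square], modulo 4 the value [s^T A^k s] is, up to the factor [c],
   the pairing of [w k] with [\sum_i x_i^2 w_(2i)]; the bound [uphalf n] keeps
   the indices [2i] below [n], so that [gram_mult4] applies. *)
Lemma walk_coeff_even (x : nat -> int) (s : 'cV[int]_n) :
  s = \sum_(i < uphalf n) x i *: w i ->
  (forall k, s^T *m A ^+ k *m s \is a multmx 4) ->
  forall i, (0 < i < uphalf n)%N -> (2 %| x i)%Z.
Proof.
move=> sE s4 i /andP[i_gt0 i_lt].
have le_half : (uphalf n <= n)%N by lia.
pose xv := \col_(j < n) (if (j < uphalf n)%N then x j else 0) : 'cV[int]_n.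
have {}sE : s = W *m xv.
  rewrite (mul_walkmx_col (fun j => if (j < uphalf n)%N then x j else 0)) sE.
  rewrite (big_ord_widen n (fun j => x j *: w j) le_half) big_mkcond /=.
  by apply: eq_bigr => j _; case: ifP; rewrite ?scale0r.
pose q k (j : nat) := x j ^+ 2 * ((w j)^T *m A ^+ k *m w j) 0 0.
have q4 k : (4 %| \sum_(j < uphalf n) q k j)%Z.
  have M_sym : (W^T *m A ^+ k *m W)^T = W^T *m A ^+ k *m W.
    by rewrite !trmx_mul trmxK trmxX A_sym mulmxA.
  have M_even (j l : 'I_n) : j != l -> (2 %| (W^T *m A ^+ k *m W) j l)%Z.
    move=> jl; apply: gram_even; rewrite lt0n addn_eq0; apply: contra jl.
    by move=> /andP[/eqP j0 /eqP l0]; apply/eqP/val_inj; rewrite /= j0 l0.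
  have := quad_form_diag xv M_sym M_even; set Q := _ *m diag_mx _ *m _.
  have -> : xv^T *m (W^T *m A ^+ k *m W) *m xv = s^T *m A ^+ k *m s.
    by rewrite sE trmx_mul !mulmxA.
  move=> H; have : Q \is a multmx 4.
    have -> : Q = s^T *m A ^+ k *m s - (s^T *m A ^+ k *m s - Q).
      by rewrite opprB addrC subrK.
    by rewrite rpredB.
  rewrite multmx11; suff -> : \sum_(j < uphalf n) q k j = Q 0 0 by [].
  rewrite /Q mul_mx_diag mxE (big_ord_widen n (q k) le_half) big_mkcond /=.
  apply: eq_bigr => j _; rewrite [X in _ = X * _]mxE [(\row__ _) _ _]mxE gramE.
  rewrite [xv^T _ _]mxE [xv _ _]mxE /q.
  case: ifP => _; last by rewrite !mul0r.
  by rewrite expr2 -!mulrA [X in _ * X]mulrC.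
(* [z] carries the left scalar of [walk_square]; [y] moves it to index [2j], so that [W y] is the
   sum of the [z_j w_(2j)]. *)
pose z (j : nat) := (if j == 0%N then c%:Z else 1) * x j ^+ 2.
pose y (j : nat) := if odd j then 0 else z j./2.
have y2 : (\col_(j < n) y j : 'cV_n) \is a multmx 2.
  apply: gram_mult4; rewrite -mulmxA mul_walkmx_col.
  have -> : \sum_(j < n) y j *: w j = \sum_(j < uphalf n) z j *: w j.*2.
    rewrite -(sum_even_index _ (fun j => z j *: w j.*2)).
    apply: eq_bigr => j _; rewrite /y; case: ifP => [|j_even].
      by rewrite scale0r.
    by congr (_ *: w _); rewrite -[LHS]odd_double_half j_even add0n.
  apply/mult_entryP => k l; rewrite ord1.
  have -> : (W^T *m \sum_(j < uphalf n) z j *: w j.*2) k 0 =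
      (if k == 0%N :> nat then c%:Z else 1) * \sum_(j < uphalf n) q k j.
    rewrite mulmx_sumr summxE mulr_sumr; apply: eq_bigr => j _.
    have /matrixP/(_ 0 0) := walk_square k j.
    rewrite -scalemxAr [X in X = _ -> _]mxE [X in _ = X -> _]mxE /q /z => H.
    rewrite mxE [RHS]mulrCA -H [RHS]mulrCA [RHS]mulrA; congr (_ * _).
    by rewrite !mxE; apply: eq_bigr => l' _; rewrite !mxE.
  exact: dvdz_mull.
have i2 : (i.*2 < n)%N by lia.
have /mult_entryP/(_ (Ordinal i2) 0) := y2.
rewrite mxE /= /y odd_double doubleK /z -[i == 0%N]negbK -lt0n i_gt0 /= mul1r.
by rewrite !dvdzE abszX Euclid_dvdX // => /andP[].
Qed.

Hypothesis n_gt0 : (0 < n)%N.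

Lemma walk_combination_mod2 (x : nat -> int) (s : 'cV[int]_n) :
  s = \sum_(i < uphalf n) x i *: w i ->
  (forall k, s^T *m A ^+ k *m s \is a multmx 4) ->
  s - x 0%N *: e \is a multmx 2.
Proof.
move=> sE s4; have x2 := walk_coeff_even sE s4.
have r_gt0 : (0 < uphalf n)%N by lia.
rewrite sE -(prednK r_gt0) big_ord_recl /= addrAC subrr add0r.
apply: rpred_sum => i _; apply/mult_entryP => j k; rewrite mxE.
apply: dvdz_mulr; apply: x2; rewrite /= /bump; have := ltn_ord i; lia.
Qed.

Definition walk_rows : 'M[int]_(uphalf n, n) := \matrix_(i, j) w i j 0.

(** The coefficient function is [X] extended by 0 to all naturals, the form taken by
    [walk_coeff_even]. *)
Lemma mul_walk_rows (X : 'rV[int]_(uphalf n)) :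
  (X *m walk_rows)^T =
  \sum_(i < uphalf n) oapp (X 0) 0 (insub (i : nat)) *: w i.
Proof.
apply/matrixP => j k; rewrite ord1 !mxE summxE; apply: eq_bigr => i _.
by rewrite valK !mxE.
Qed.

(** A relation mod 2 gives an even combination [s], hence [s^T A^k s] divisible by 4: all
    coefficients past the first are even, and then so is the first, read off from [x_0 1]. *)
Lemma walk_rows_free : row_free (map_mx intr walk_rows : 'M['F_2]_(_, n)).
Proof.
apply: inj_row_free => v vP; have [X XE] := intr_Fp_surj v.
pose x k := oapp (X 0) 0 (insub k) : int; pose s := (X *m walk_rows)^T.
have sE : s = \sum_(i < uphalf n) x i *: w i by exact: mul_walk_rows.
have s2 : s \is a multmx 2 by rewrite tr_multmx multmx_Fp // map_mxM /= XE vP.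
have s4 k : s^T *m A ^+ k *m s \is a multmx 4.
  by rewrite (@multmxM 2 2) // multmxMl // tr_multmx.
have x2 := walk_coeff_even (x := x) sE s4.
rewrite -XE; apply/eqP; rewrite -multmx_Fp //.
apply/mult_entryP => j i; rewrite ord1.
have -> : X 0 i = x i by rewrite /x valK.
have [i0|i_gt0] := posnP i; last by apply: x2; rewrite i_gt0 ltn_ord.
have := rpredB s2 (walk_combination_mod2 (x := x) sE s4).
rewrite opprB addrC subrK.
by move=> /mult_entryP/(_ (Ordinal n_gt0) 0); rewrite mxE mxE mulr1 i0.
Qed.

(** Sylvester's inequality bounds [2 rank W - n] by the rank of [W^T W], which mod 2 has at most its
    corner entry nonzero, and only for odd [n]. *)
Lemma rank_walkmx_le : (\rank (map_mx intr W : 'M['F_2]_n) <= uphalf n)%N.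
Proof.
pose W2 := map_mx intr W : 'M['F_2]_n.
have := mxrank_mul_min W2^T W2; rewrite mxrank_tr.
have : (\rank (W2^T *m W2) <= odd n)%N.
  have -> : W2^T *m W2 =
      (odd n)%:R *: delta_mx (Ordinal n_gt0) (Ordinal n_gt0).
    have -> : W2^T *m W2 = map_mx intr (W^T *m W) by rewrite map_mxM map_trmx.
    apply/matrixP => i j; rewrite [LHS]mxE [RHS]mxE [delta_mx _ _ _ _]mxE.
    have [/eqP|ij] := posnP (i + j)%N; last first.
      have -> : (i == Ordinal n_gt0) && (j == Ordinal n_gt0) = false.
        by apply/negbTE/negP => /andP[/eqP iE /eqP jE]; rewrite iE jE in ij.
      rewrite mulr0; apply/eqP; rewrite -(dvdz_pcharf (@pchar_Fp 2 isT)).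
      by have := gram_even 0 ij; rewrite expr0 mulmx1.
    rewrite addn_eq0 => /andP[/eqP i0 /eqP j0].
    rewrite -!val_eqE /= i0 j0 mulr1.
    have := gramE 0 i j; rewrite expr0 mulmx1 i0 j0 /= => ->.
    rewrite mulmx1 mxE (eq_bigr (fun _ => 1)) => [|l _]; last by rewrite !mxE.
    rewrite sumr_const card_ord natz -pmulrn -{1}(odd_double_half n) natrD -muln2.
    by rewrite natrM (pchar_Fp_0 (isT : prime 2)) mulr0 addr0.
  case: (odd n); last by rewrite scale0r mxrank0.
  by rewrite scale1r mxrank_delta.
rewrite -/W2 uphalf_half; have := odd_double_half n.
move: (\rank W2) (\rank (W2^T *m W2)) (nat_of_bool (odd n)) n./2.
by move=> r1 r2 b h; rewrite -addnn; lia.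
Qed.

(** By the two rank bounds the first [uphalf n] walk vectors span the column space mod 2, which
    contains [m^2 u], congruent to [u]. *)
Lemma walk_span_mod2 (u : 'cV[int]_n) :
  W^T *m u \is a multmx 2 -> exists x : nat -> int,
    u - \sum_(i < uphalf n) x i *: w i \is a multmx 2.
Proof.
move=> /walk_combination[y Wy]; pose red := fun m k (M : 'M[int]_(m, k)) =>
  map_mx intr M : 'M['F_2]_(m, k).
have le_half : (uphalf n <= n)%N by lia.
have rows_W : (red _ _ walk_rows <= (red _ _ W)^T)%MS.
  apply/row_subP => i; have := row_sub (widen_ord le_half i) (red _ _ W)^T.
  by congr (_ <= _)%MS; apply/rowP => j; rewrite !mxE.
have W_rows : ((red _ _ W)^T <= red _ _ walk_rows)%MS.
  rewrite -(mxrank_leqif_sup rows_W) eqn_leq mxrankS //= mxrank_tr.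
  by have /eqP -> := walk_rows_free; apply: rank_walkmx_le.
have /submxP[v uv] : ((red _ _ u)^T <= red _ _ walk_rows)%MS.
  apply: submx_trans W_rows; apply/submxP; exists (red _ _ y)^T.
  rewrite -trmx_mul /red -map_mxM Wy map_mxZ /=.
  have m2_odd : ~~ (2 %| m ^+ 2)%Z by rewrite !dvdzE abszX Euclid_dvdX // andbT.
  have -> : (m ^+ 2)%:~R = 1 :> 'F_2.
    move: m2_odd; rewrite (dvdz_pcharf (@pchar_Fp 2 isT)).
    by case: (_%:~R) => -[|[|]] // lt2 _; apply: val_inj.
  by rewrite scale1r.
have [X XE] := intr_Fp_surj v.
exists (fun k => oapp (X 0) 0 (insub k)); rewrite -mul_walk_rows.
rewrite multmx_Fp // map_mxB -map_trmx map_mxM /= XE -uv trmxK.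
by rewrite subrr.
Qed.

Lemma column_mod2 (u : 'cV[int]_n) :
  W^T *m u \is a multmx 2 -> (forall k, u^T *m A ^+ k *m u \is a multmx 4) ->
  exists x0 : int, u - x0 *: e \is a multmx 2.
Proof.
move=> Wu u4; have [x ux] := walk_span_mod2 Wu; exists (x 0%N).
pose s := \sum_(i < uphalf n) x i *: w i.
(* Changing [u] by [2 t] changes the form by a multiple of 4, the two cross terms being equal by
   symmetry. *)
have s4 k : s^T *m A ^+ k *m s \is a multmx 4.
  have /multmxP[t ut] := ux.
  have -> : s = u - 2%:Z *: t by rewrite -ut opprB addrC subrK.
  have Ak_sym : (A ^+ k)^T = A ^+ k by rewrite trmxX A_sym.
  have -> : (u - 2%:Z *: t)^T *m A ^+ k *m (u - 2%:Z *: t) =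
    u^T *m A ^+ k *m u + 4%:Z *: (t^T *m A ^+ k *m t - t^T *m A ^+ k *m u).
    have E : u^T *m A ^+ k *m t = t^T *m A ^+ k *m u.
      by rewrite -[LHS]trmx11 !trmx_mul trmxK Ak_sym mulmxA.
    rewrite [(_ - _)^T]linearB /= [(_ *: t)^T]linearZ /= mulmxBr.
    rewrite !mulmxBl -!scalemxAr -!scalemxAl.
    by rewrite E; apply/matrixP => i j; rewrite !mxE; ring.
  by rewrite rpredD //; apply/multmxP; eexists.
have := rpredD ux (walk_combination_mod2 (x := x) (erefl s) s4).
by rewrite addrA subrK.
Qed.

End WalkParity.

(** * Integral versions of the rational graph matrices *)

Lemma numq_mxK (m n : nat) (M : 'M[rat]_(m, n)) :
  M \is a mxOver (Num.int : {pred rat}) -> map_mx intr (map_mx numq M) = M.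
Proof.
move=> /mxOverP M_int; apply/matrixP => i j; rewrite !mxE.
by have /intrP[k ->] := M_int i j; rewrite numq_int.
Qed.

Lemma intr_mx_inj (m n : nat) :
  injective (map_mx intr : 'M[int]_(m, n) -> 'M[rat]_(m, n)).
Proof.
move=> M N /matrixP MN; apply/matrixP => i j.
by have := MN i j; rewrite !mxE => /intr_inj.
Qed.

Lemma intr_mxX (n : nat) (A : 'M[int]_n) (k : nat) :
  map_mx intr (A ^+ k) = map_mx intr A ^+ k :> 'M[rat]_n.
Proof.
elim: k => [|k IH]; first by rewrite !expr0 map_mx1.
by rewrite !exprS -!mulmxE map_mxM IH.
Qed.

Section IntegralGraphMatrices.

Variables (alpha : rat) (n : nat) (G : sgraph n).

Definition Acalpha_mx : 'M[int]_n := map_mx numq (Acalpha alpha G).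
Definition degree_cv : 'cV[int]_n := \col_u (degree G u)%:Z.

Lemma intr_Acalpha_mx : map_mx intr Acalpha_mx = Acalpha alpha G.
Proof. exact/numq_mxK/Acalpha_int. Qed.

Lemma c_alpha_gt0 : (0 < c_alpha alpha)%N.
Proof. by have /and3P[] := c_alphaP alpha. Qed.

Lemma Acalpha_mx_sym : Acalpha_mx^T = Acalpha_mx.
Proof.
have adj_tr : (adjm G)^T = adjm G.
  by apply/matrixP => i j; rewrite !mxE adj_sym.
apply: intr_mx_inj; rewrite -map_trmx intr_Acalpha_mx /Acalpha /Aalpha.
by rewrite linearZ /= linearD /= !linearZ /= tr_diag_mx adj_tr.
Qed.

Lemma intr_degree_cv : map_mx intr degree_cv = \col_u (degree G u)%:R :> 'cV[rat]_n.
Proof. by apply/matrixP => i j; rewrite !mxE. Qed.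

Lemma intr_ones : map_mx intr (const_mx 1 : 'cV[int]_n) = ones n.
Proof. by apply/matrixP => i j; rewrite !mxE. Qed.

Lemma Acalpha_mx_ones :
  Acalpha_mx *m const_mx 1 = (c_alpha alpha)%:Z *: degree_cv.
Proof.
apply: intr_mx_inj; rewrite map_mxM map_mxZ intr_Acalpha_mx intr_ones.
by rewrite intr_degree_cv /Acalpha -scalemxAl Aalpha_ones.
Qed.

Lemma Acalpha_mx_diag :
  \row_i Acalpha_mx i i = numq ((c_alpha alpha)%:R * alpha) *: degree_cv^T.
Proof.
have /and3P[_ /intrP[a aE] _] := c_alphaP alpha.
apply/rowP => i; apply: (@intr_inj rat).
have /matrixP/(_ i i) := intr_Acalpha_mx; rewrite [LHS]mxE => H.
rewrite [X in X%:~R]mxE H /Acalpha /Aalpha !mxE eqxx adj_irr.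
rewrite mulr0 addr0 mulrA aE numq_int.
by rewrite rmorphM.
Qed.

(** Handshake lemma, as the form of the adjacency matrix, with zero diagonal, at the all-ones
    vector. *)
Lemma sum_degree_even : (const_mx 1 : 'cV_n)^T *m degree_cv \is a multmx 2.
Proof.
pose B := \matrix_(u, v) (G u v)%:Z : 'M[int]_n.
have B_sym : B^T = B by apply/matrixP => i j; rewrite !mxE adj_sym.
have := quad_form_mod2 (const_mx 1) B_sym.
have -> : \row_i B i i = 0 by apply/rowP => i; rewrite !mxE adj_irr.
rewrite mul0mx subr0 -mulmxA; suff -> : B *m const_mx 1 = degree_cv by [].
apply/matrixP => i j; rewrite !mxE /degree -sum1_card.
rewrite (big_morph Posz PoszD (erefl _)) [RHS]big_mkcond /=.
by apply: eq_bigr => v _; rewrite !mxE inE mulr1; case: (G i v).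
Qed.

Lemma Wtilde_walkmx : Wtilde alpha G = map_mx intr (walkmx Acalpha_mx degree_cv).
Proof.
apply/matrixP => i j; rewrite [LHS]mxE [RHS]mxE [walkmx _ _ _ _]mxE.
case: (nat_of_ord j) => [|k] /=.
  by rewrite !mxE.
have c_neq0 : (c_alpha alpha)%:R != 0 :> rat by rewrite pnatr_eq0 -lt0n c_alpha_gt0.
rewrite exprSr -mulmxE -mulmxA {2}/Acalpha -scalemxAl -scalemxAr Aalpha_ones.
rewrite mxE mulrC mulKf //.
have <- := intr_degree_cv; rewrite -intr_Acalpha_mx -intr_mxX -map_mxM.
by rewrite [LHS]mxE.
Qed.

Lemma det_Wtilde_walkmx (m : int) :
  \det (Wtilde alpha G) / 2 ^+ n./2 = m%:~R ->
  \det (walkmx Acalpha_mx degree_cv) = 2 ^+ n./2 * m.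
Proof.
rewrite Wtilde_walkmx det_map_mx => H; apply: (@intr_inj rat).
by rewrite rmorphM rmorphXn /= -H mulrC divfK // expf_neq0.
Qed.

Lemma Wtilde_int_walkmx : Wtilde_int alpha G = walkmx Acalpha_mx degree_cv.
Proof. by apply: intr_mx_inj; rewrite Wtilde_intE Wtilde_walkmx. Qed.

End IntegralGraphMatrices.

(** * The integral matrix [Q = l U] and its congruences *)

Definition level_mx (n : nat) (U : 'M[rat]_n) : 'M[int]_n :=
  map_mx numq ((level U)%:R *: U).

Lemma levelP (n : nat) (U : 'M[rat]_n) : level_pred U (level U).
Proof. by rewrite /level; case: ex_minnP. Qed.

Lemma intr_level_mx (n : nat) (U : 'M[rat]_n) :
  map_mx intr (level_mx U) = (level U)%:R *: U.
Proof. by apply: numq_mxK; have /andP[] := levelP U. Qed.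

(** Otherwise [l / q] would already clear the denominators of [U], against minimality of the
    level. *)
Lemma level_primitive (n q : nat) (U : 'M[rat]_n) :
  (1 < q)%N -> (q %| level U)%N -> level_mx U \isn't a multmx q.
Proof.
move=> q_gt1 /dvdnP[k lE]; apply/negP => /multmxP[N QE].
have /andP[l_gt0 _] := levelP U.
have k_gt0 : (0 < k)%N by move: l_gt0; rewrite lE muln_gt0 => /andP[].
have kU : k%:R *: U = map_mx intr N.
  have q_neq0 : q%:R != 0 :> rat by rewrite pnatr_eq0 -lt0n ltnW.
  apply: (scalerI q_neq0); rewrite scalerA -natrM mulnC -lE -intr_level_mx QE.
  by rewrite map_mxZ.
suff : (level U <= k)%N by rewrite lE leqNgt ltn_Pmulr.
rewrite {1}/level; case: ex_minnP => l _; apply.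
by rewrite /level_pred k_gt0 kU; apply/mxOverP => i j; rewrite mxE intr_int.
Qed.

Section GammaColumns.

Variables (alpha : rat) (n : nat) (G H : sgraph n) (U : 'M[rat]_n).
Hypothesis U_orth : rat_orthogonal U.
Hypothesis U_ones : U *m ones n = ones n.
Hypothesis U_conj : U^T *m Acalpha alpha G *m U = Acalpha alpha H.

Local Notation l := (level U).
Local Notation Q := (level_mx U).
Local Notation A := (Acalpha_mx alpha G).
Local Notation B := (Acalpha_mx alpha H).

Lemma level_mx_conj (k : nat) : A ^+ k *m Q = Q *m B ^+ k.
Proof.
elim: k => [|k IH]; first by rewrite !expr0 mul1mx mulmx1.
rewrite exprSr -mulmxE -mulmxA; have -> : A *m Q = Q *m B.
  have AU : Acalpha alpha G *m U = U *m Acalpha alpha H.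
    by rewrite -U_conj !mulmxA (mulmx1C U_orth) mul1mx.
  apply: intr_mx_inj; rewrite !map_mxM !intr_Acalpha_mx intr_level_mx.
  by rewrite -[LHS]scalemxAr AU -[RHS]scalemxAl.
by rewrite mulmxA IH -mulmxA mulmxE -exprSr.
Qed.

Lemma level_mx_orth : Q^T *m Q = ((l ^ 2)%N%:Z)%:M.
Proof.
apply: intr_mx_inj; rewrite map_mxM -map_trmx intr_level_mx [(_ *: U)^T]linearZ /=.
rewrite -scalemxAl -scalemxAr scalerA U_orth map_scalar_mx /= scalemx1.
by rewrite -pmulrn -natrM mulnn.
Qed.

Lemma level_mx_quad (k : nat) : Q^T *m A ^+ k *m Q \is a multmx (l ^ 2)%N.
Proof.
rewrite -mulmxA level_mx_conj mulmxA level_mx_orth mul_scalar_mx.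
by apply/multmxP; exists (B ^+ k).
Qed.

Lemma ones_level_mx :
  (const_mx 1 : 'cV_n)^T *m Q = l%:Z *: (const_mx 1 : 'cV_n)^T.
Proof.
apply: intr_mx_inj; rewrite map_mxM map_mxZ -map_trmx intr_ones intr_level_mx.
by rewrite -scalemxAr -{1}U_ones trmx_mul -mulmxA U_orth mulmx1.
Qed.

(** [c d^T A^k] is [1^T A^(k+1)], which conjugation carries past [Q]; then [c] cancels over the
    integers. *)
Lemma degree_level_mx (k : nat) :
  (degree_cv G)^T *m A ^+ k *m Q = l%:Z *: ((degree_cv H)^T *m B ^+ k).
Proof.
have c_neq0 : (c_alpha alpha)%:Z != 0 by rewrite eqz_nat -lt0n c_alpha_gt0.
have scaleI : injective ( *:%R (c_alpha alpha)%:Z : 'rV[int]_n -> _).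
  move=> x y /rowP xy; apply/rowP => i.
  by have := xy i; rewrite !mxE; apply: mulfI.
apply: scaleI; rewrite scalemxAl -(ones_expA (Acalpha_mx_sym alpha G)) //; last first.
  exact: Acalpha_mx_ones.
rewrite -mulmxA level_mx_conj mulmxA ones_level_mx -scalemxAl.
rewrite (ones_expA (Acalpha_mx_sym alpha H) (Acalpha_mx_ones alpha H)).
by rewrite !scalerA mulrC.
Qed.

Lemma walkmx_level_mx :
  (walkmx A (degree_cv G))^T *m Q \is a multmx l.
Proof.
rewrite -tr_multmx trmx_mul trmxK; apply/multmx_walkmx => j _.
rewrite -tr_multmx trmx_mul trmxK; apply/multmxP; case: j => [|k] /=.
  by rewrite ones_level_mx; eexists.
by rewrite trmx_mul trmxX Acalpha_mx_sym degree_level_mx; eexists.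
Qed.

Lemma degree_level_mult (k : nat) :
  (degree_cv G)^T *m A ^+ k *m Q \is a multmx l.
Proof. by rewrite degree_level_mx; apply/multmxP; eexists. Qed.

Lemma ones_level_mult : (const_mx 1 : 'cV_n)^T *m Q \is a multmx l.
Proof. by rewrite ones_level_mx; apply/multmxP; eexists. Qed.

End GammaColumns.

(** * Passage to a column of [Q], and the conclusion *)

Lemma col_multmx (q m n : nat) (M : 'M[int]_(m, n)) :
  M \isn't a multmx q -> exists j, col j M \isn't a multmx q.
Proof.
move=> M_q; apply/existsP; apply: contraR M_q; rewrite negb_exists => /forallP H.
apply/mult_entryP => i j; have /negPn/mult_entryP/(_ i 0) := H j.
by rewrite mxE.
Qed.

Lemma multmx_col (q m n k : nat) (M : 'M[int]_(m, n)) (N : 'M[int]_(n, k)) j :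
  M *m N \is a multmx q -> M *m col j N \is a multmx q.
Proof. by move=> MN; rewrite colE mulmxA multmxMl. Qed.

Lemma col_quad_multmx (q n : nat) (M N : 'M[int]_n) j :
  N^T *m M *m N \is a multmx q -> (col j N)^T *m M *m col j N \is a multmx q.
Proof.
by move=> H; rewrite !colE trmx_mul -!mulmxA multmxMr // !mulmxA multmxMl.
Qed.

Lemma multmx_dvd (q1 q2 m n : nat) (M : 'M[int]_(m, n)) : (q1 %| q2)%N ->
  M \is a multmx q2 -> M \is a multmx q1.
Proof.
move=> q12 /mult_entryP H; apply/mult_entryP => i j.
by apply: dvdz_trans (H i j); rewrite dvdzE.
Qed.

Theorem theorem3p2 (alpha : rat) (n : nat) (G : sgraph n) (U : 'M[rat]_n) :
  0 <= alpha < 1 ->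
  (5 <= n)%N ->
  connected G ->
  in_F alpha G ->
  in_Gamma alpha G U ->
  ~ [/\ ~~ odd n, odd (c_alpha alpha) & (3 <= c_alpha alpha)%N] ->
  odd (level U).
Proof.
move=> _ n_ge5 _ [[m [/det_Wtilde_walkmx detW m_odd m_sqf]] rank_W]
  [U_orth U_ones [H U_conj]] _.
set l := level U; apply/negPn/negP => l_even.
have /andP[l_gt0 _] : level_pred U l := levelP U.
set A := Acalpha_mx alpha G in detW *; pose d := degree_cv G; pose Q := level_mx U.
have A_sym : A^T = A := Acalpha_mx_sym alpha G.
have A_ones := Acalpha_mx_ones alpha G.
have WQ : (walkmx A d)^T *m Q \is a multmx l by apply: walkmx_level_mx U_conj.
have quadQ k : Q^T *m A ^+ k *m Q \is a multmx (l ^ 2)%N.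
  by apply: level_mx_quad U_conj _.
have m_odd2 : ~~ (2 %| m)%Z by rewrite dvdzE dvdn2 negbK.
have l2 : (2 %| l)%N by rewrite dvdn2.
have l4 : ~~ (4 %| l)%N.
  apply/negP => l4; have := level_primitive (isT : (1 < 2)%N) l2.
  move=> /col_multmx[j]; case/negP.
  apply: (walk_mult4 A_sym A_ones (Acalpha_mx_diag alpha G)
    (sum_degree_even G) detW m_odd2).
  exact/multmx_col/(multmx_dvd l4).
have odd_prime p : prime p -> odd p -> ~~ (p %| l)%N.
  move=> p_pr p_odd; apply/negP => pl.
  have [j un] := col_multmx (level_primitive (prime_gt1 p_pr) pl).
  set u := col j _ in un; have un' : u^T \isn't a multmx p by rewrite tr_multmx.
  have uW : u^T *m walkmx A d \is a multmx p.
    rewrite -tr_multmx trmx_mul trmxK; exact/multmx_col/(multmx_dvd pl).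
  (* If [p] divided [c_alpha], the walk matrix would be invertible mod [p], yet it kills the nonzero
     vector [u]. *)
  have pc : coprime p (c_alpha alpha).
    rewrite prime_coprime //; apply/negP => /(rank_W p p_pr p_odd) rk.
    case/negP: un'; rewrite multmx_Fp //; apply/eqP.
    have Wf : row_free (map_mx intr (Wtilde_int alpha G) : 'M['F_p]_n).
      by rewrite /row_free rk.
    apply: (row_free_inj Wf); rewrite mul0mx -map_mxM Wtilde_int_walkmx.
    by apply/eqP; rewrite -multmx_Fp.
  have pl2 : (p ^ 2 %| l ^ 2)%N by rewrite dvdn_exp2r.
  have p2W : ((p ^ 2)%N %| \det (walkmx A d))%Z.
    apply: (sq_dvd_det_walkmx (u := u^T) p_pr pc A_sym A_ones) => //.
    - have := multmx_dvd pl2 (quadQ 0%N); rewrite expr0 => /(col_quad_multmx j).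
      by rewrite mulmx1 trmxK.
    - have := multmx_dvd pl2 (quadQ 1%N); rewrite expr1 => /(col_quad_multmx j).
      by rewrite trmxK.
    - move=> k; rewrite -tr_multmx !trmx_mul trmxK trmxX A_sym.
      apply/multmx_col/(multmx_dvd pl); exact: degree_level_mult U_ones U_conj _.
    - rewrite -tr_multmx trmx_mul trmxK.
      by apply/multmx_col/(multmx_dvd pl)/ones_level_mult.
  have p2m : (p ^ 2 %| `|m|)%N.
    move: p2W; rewrite detW dvdzE abszM abszX Gauss_dvdr //=.
    by rewrite coprimeXl // coprimeXr // coprime_sym prime_coprime // dvdn2 p_odd.
  by have p1 := m_sqf p p2m; rewrite p1 in p_pr.
(* Writing [l = 2k], a prime factor of [k] is either odd or yields 4 as a divisor of [l]. *)
have l_eq2 : l = 2%N.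
  have [k lE] := dvdnP l2; have [k_le1|k_gt1] := leqP k 1.
    by case: k lE k_le1 => [|[|k]] // lE _; rewrite lE in l_gt0.
  have p_pr := pdiv_prime k_gt1; have pk := pdiv_dvd k.
  have [p_odd|] := boolP (odd (pdiv k)).
    by have := odd_prime _ p_pr p_odd; rewrite lE dvdn_mulr.
  case: (even_prime p_pr) => [p2 _|-> //]; rewrite p2 in pk.
  by move: l4; rewrite lE (dvdn_mul pk (dvdnn 2)).
have [j un] := col_multmx (level_primitive (isT : (1 < 2)%N) l2).
set u := col j _ in un.
have [x0 ux] : exists x0 : int, u - x0 *: const_mx 1 \is a multmx 2.
  apply: (column_mod2 A_sym A_ones (Acalpha_mx_diag alpha G)
    (sum_degree_even G) detW m_odd2).
  - exact: leq_trans n_ge5.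
  - exact/multmx_col/(multmx_dvd l2).
  by move=> k; apply/col_quad_multmx; have := quadQ k; rewrite l_eq2.
(* A zero entry would make [x0] even, and with it the whole column [u]. *)
have u_neq0 i : 1 <= u i 0 ^+ 2.
  suff : u i 0 != 0 by rewrite -gtz0_ge1 exprn_even_gt0.
  apply: contra un => /eqP ui0; have /mult_entryP ux2 := ux.
  have x02 : (2 %| x0)%Z.
    by have := ux2 i 0; rewrite !mxE in ui0 *; rewrite ui0 mulr1 sub0r !dvdzE abszN.
  rewrite -[u](subrK (x0 *: const_mx 1)) rpredD //.
  by apply/mult_entryP => i' j'; rewrite !mxE mulr1.
have : \sum_i u i 0 ^+ 2 = 4.
  have /matrixP/(_ j j) := level_mx_orth U_orth.
  rewrite -/l l_eq2 !mxE eqxx => QQ.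
  rewrite (_ : 4 = (2 ^ 2)%N%:Z *+ true) // -QQ.
  by apply: eq_bigr => i _; rewrite !mxE expr2.
have : \sum_(i < n) 1 <= \sum_(i < n) u i 0 ^+ 2 :> int by apply: ler_sum.
by rewrite sumr_const card_ord => + uE; rewrite uE natz => n4; lia.
Qed.
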